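(* Let $\kappa$ be an uncountable cardinal and let $X$ be either the Cantor cube $\{0,1\}^\kappa$ or the Tychonoff cube $[0,1]^\kappa$ (product topology). Then $X$ is reconstructible. Moreover, for every $x \in X$ the card $X \setminus \{x\}$ is not compact, not paracompact, not Lindel\''of and not normal.
   Context: For a topological space $X$ and $x \in X$, the set $X\setminus\{x\}$ carries the subspace topology. A card of $X$ is a space homeomorphic to $X \setminus \{x\}$ for some $x \in X$. The deck of $X$ is $\mathcal{D}(X)=\{[X\setminus\{x\}]_\sim : x \in X\}$, where $[Y]_\sim$ denotes the homeomorphism class of $Y$. A space $Z$ is a reconstruction of $X$ if $\mathcal{D}(Z)=\mathcal{D}(X)$. A space $X$ is reconstructible if every reconstruction of $X$ is homeomorphic to $X$. *)

(* Defs.v *)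
From Stdlib Require Import Reals Lra List.
Open Scope R_scope.

Record TopSpace := mkTop {
  carrier :> Type;
  is_open : (carrier -> Prop) -> Prop;
  open_full : is_open (fun _ => True);
  open_inter : forall U V, is_open U -> is_open V -> is_open (fun x => U x /\ V x);
  open_union : forall F : (carrier -> Prop) -> Prop,
      (forall U, F U -> is_open U) -> is_open (fun x => exists U, F U /\ U x)
}.

Definition is_closed (X : TopSpace) (C : X -> Prop) : Prop :=
  is_open X (fun x => ~ C x).

Section Subspace.
Variables (X : TopSpace) (P : X -> Prop).
Definition sub_open (U : {x : X | P x} -> Prop) : Prop :=
  exists V, is_open X V /\ forall y, U y <-> V (proj1_sig y).

Lemma sub_open_full : sub_open (fun _ => True).
Proof. exists (fun _ => True); split; [apply open_full | tauto]. Qed.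

Lemma sub_open_inter : forall U V, sub_open U -> sub_open V ->
  sub_open (fun x => U x /\ V x).
Proof.
  intros U V [U' [HU' EU]] [V' [HV' EV]].
  exists (fun x => U' x /\ V' x); split; [apply open_inter; auto|].
  intros y; rewrite EU, EV; tauto.
Qed.

Lemma sub_open_union : forall F, (forall U, F U -> sub_open U) ->
  sub_open (fun x => exists U, F U /\ U x).
Proof.
  intros F HF.
  exists (fun x => exists V, (is_open X V /\
      (exists U, F U /\ forall y, U y <-> V (proj1_sig y))) /\ V x).
  split.
  - apply open_union; intros V [HV _]; exact HV.
  - intros y; split.
    + intros [U [FU Uy]]. destruct (HF U FU) as [V [HV EV]].
      exists V; split; [split; [exact HV| exists U; split; auto] | apply EV; exact Uy].
    + intros [V [[HV [U [FU EU]]] Vy]]. exists U; split; auto; apply EU; exact Vy.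
Qed.

Definition subspace : TopSpace :=
  mkTop {x : X | P x} sub_open sub_open_full sub_open_inter sub_open_union.
End Subspace.

Definition card (X : TopSpace) (x : X) : TopSpace :=
  subspace X (fun y => y <> x).

Definition continuous (X Y : TopSpace) (f : X -> Y) : Prop :=
  forall V, is_open Y V -> is_open X (fun x => V (f x)).

Definition homeomorphic (X Y : TopSpace) : Prop :=
  exists (f : X -> Y) (g : Y -> X),
    (forall x, g (f x) = x) /\ (forall y, f (g y) = y) /\
    continuous X Y f /\ continuous Y X g.

Definition same_deck (X Z : TopSpace) : Prop :=
  (forall x : X, exists z : Z, homeomorphic (card X x) (card Z z)) /\
  (forall z : Z, exists x : X, homeomorphic (card X x) (card Z z)).

Definition reconstructible (X : TopSpace) : Prop :=
  forall Z : TopSpace, same_deck Z X -> homeomorphic Z X.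

Definition open_family (X : TopSpace) (F : (X -> Prop) -> Prop) : Prop :=
  forall U, F U -> is_open X U.
Definition covers (X : TopSpace) (F : (X -> Prop) -> Prop) : Prop :=
  forall x : X, exists U, F U /\ U x.

Definition compact (X : TopSpace) : Prop :=
  forall F, open_family X F -> covers X F ->
    exists l : list (X -> Prop), (forall U, In U l -> F U) /\
      (forall x : X, exists U, In U l /\ U x).

Definition countable_family (X : TopSpace) (G : (X -> Prop) -> Prop) : Prop :=
  exists e : nat -> (X -> Prop), forall U, G U -> exists n, e n = U.

Definition lindelof (X : TopSpace) : Prop :=
  forall F, open_family X F -> covers X F ->
    exists G, (forall U, G U -> F U) /\ countable_family X G /\ covers X G.

Definition locally_finite (X : TopSpace) (G : (X -> Prop) -> Prop) : Prop :=
  forall x : X, exists W, is_open X W /\ W x /\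
    exists l : list (X -> Prop),
      forall V, G V -> (exists y, V y /\ W y) -> In V l.

Definition paracompact (X : TopSpace) : Prop :=
  forall F, open_family X F -> covers X F ->
    exists G, open_family X G /\ covers X G /\
      (forall V, G V -> exists U, F U /\ forall x, V x -> U x) /\
      locally_finite X G.

Definition normal (X : TopSpace) : Prop :=
  forall A B : X -> Prop, is_closed X A -> is_closed X B ->
    (forall x, ~ (A x /\ B x)) ->
    exists U V, is_open X U /\ is_open X V /\
      (forall x, A x -> U x) /\ (forall x, B x -> V x) /\
      (forall x, ~ (U x /\ V x)).

Section Product.
Variables (K : Type) (Y : TopSpace).
Definition prod_open (U : (K -> Y) -> Prop) : Prop :=
  forall x, U x -> exists l : list (K * (Y -> Prop)),
    (forall p, In p l -> is_open Y (snd p)) /\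
    (forall p, In p l -> snd p (x (fst p))) /\
    (forall y, (forall p, In p l -> snd p (y (fst p))) -> U y).

Lemma prod_open_full : prod_open (fun _ => True).
Proof. intros x _; exists nil; simpl; repeat split; tauto. Qed.

Lemma prod_open_inter : forall U V, prod_open U -> prod_open V ->
  prod_open (fun x => U x /\ V x).
Proof.
  intros U V HU HV x [Ux Vx].
  destruct (HU x Ux) as [l1 [A1 [B1 C1]]]; destruct (HV x Vx) as [l2 [A2 [B2 C2]]].
  exists (l1 ++ l2); repeat split.
  - intros p Hp; apply in_app_or in Hp; destruct Hp; auto.
  - intros p Hp; apply in_app_or in Hp; destruct Hp; auto.
  - apply C1; intros p Hp; apply H; apply in_or_app; auto.
  - apply C2; intros p Hp; apply H; apply in_or_app; auto.
Qed.

Lemma prod_open_union : forall F, (forall U, F U -> prod_open U) ->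
  prod_open (fun x => exists U, F U /\ U x).
Proof.
  intros F HF x [U [FU Ux]].
  destruct (HF U FU x Ux) as [l [A [B C]]].
  exists l; repeat split; auto. intros y Hy; exists U; auto.
Qed.

Definition product_space : TopSpace :=
  mkTop (K -> Y) prod_open prod_open_full prod_open_inter prod_open_union.
End Product.

Definition discrete_bool : TopSpace :=
  mkTop bool (fun _ => True) I (fun _ _ _ _ => I) (fun _ _ => I).

Definition R_open (U : R -> Prop) : Prop :=
  forall x, U x -> exists eps, 0 < eps /\ forall y, Rabs (y - x) < eps -> U y.

Lemma R_open_full : R_open (fun _ => True).
Proof. intros x _; exists 1; split; [lra | auto]. Qed.

Lemma R_open_inter : forall U V, R_open U -> R_open V -> R_open (fun x => U x /\ V x).
Proof.
  intros U V HU HV x [Ux Vx].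
  destruct (HU x Ux) as [e1 [P1 H1]]; destruct (HV x Vx) as [e2 [P2 H2]].
  exists (Rmin e1 e2); split.
  - apply Rmin_glb_lt; auto.
  - intros y Hy; split.
    + apply H1; eapply Rlt_le_trans; [exact Hy| apply Rmin_l].
    + apply H2; eapply Rlt_le_trans; [exact Hy| apply Rmin_r].
Qed.

Lemma R_open_union : forall F, (forall U, F U -> R_open U) ->
  R_open (fun x => exists U, F U /\ U x).
Proof.
  intros F HF x [U [FU Ux]]. destruct (HF U FU x Ux) as [e [Pe He]].
  exists e; split; auto. intros y Hy; exists U; auto.
Qed.

Definition R_space : TopSpace := mkTop R R_open R_open_full R_open_inter R_open_union.

Definition unit_interval : TopSpace := subspace R_space (fun r => 0 <= r <= 1).

Definition cantor_cube (K : Type) : TopSpace := product_space K discrete_bool.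
Definition tychonoff_cube (K : Type) : TopSpace := product_space K unit_interval.

Definition uncountable (K : Type) : Prop :=
  ~ exists f : K -> nat, forall a b, f a = f b -> a = b.

Definition reconstructible_with_bad_cards (X : TopSpace) : Prop :=
  reconstructible X /\
  forall x : X, ~ compact (card X x) /\ ~ paracompact (card X x) /\
                ~ lindelof (card X x) /\ ~ normal (card X x).

(* Main.v *)
(** Write [spike x k] for the point obtained from [x] by changing its [k]-th
    coordinate.  The engine is the following fact: if [x] is in the closure of
    an open subset [U] of an uncountable power of a first countable space, then
    [spike x k] is in the closure of [U] for all but countably many [k].

    Hence [x] cannot be accumulated by two disjoint open sets that cover
    a punctured neighbourhood of [x].  If all cards of [Z] are cards of the
    cube [X], then [Z] is Hausdorff, locally compact and without isolated
    points.  Extend [X \ {x} ~ Z \ {z}] by [x |-> z] and let [U] be an open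
    neighbourhood of [z] inside a compact [C].  The boundary part [C \ U] is
    compact, so near [x] the cube is covered by [x] and the preimages of [U] and
    of the complement of [C]; the former accumulates at [x], so the latter does
    not, and the extension is continuous at [x].  A continuous bijection from
    a compact space to a Hausdorff space is a homeomorphism.

    The set of all [spike x k] is closed and discrete in [X \ {x}]; by the same
    fact a countably infinite part of it cannot be separated from the rest,
    which excludes normality and paracompactness.  The sets [{p | p k <> x k}]
    form a cover without countable subcover. *)

Require Import Defs.
From Stdlib Require Import Reals Lra Lia List Cantor.
From Stdlib Require Import Classical ClassicalEpsilon.
From Stdlib Require Import FunctionalExtensionality PropExtensionality.
From mathcomp Require classical_sets.
(* [Reals] shadows [compact]. *)
Import Defs.

Lemma pred_ext {A : Type} (P Q : A -> Prop) : (forall a, P a <-> Q a) -> P = Q.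
Proof.
  intros H; apply functional_extensionality; intros a.
  apply propositional_extensionality; apply H.
Qed.

Lemma sig_eq {A : Type} {P : A -> Prop} (a b : {x : A | P x}) :
  proj1_sig a = proj1_sig b -> a = b.
Proof.
  destruct a as [a Ha], b as [b Hb]; simpl; intros E; subst b.
  f_equal; apply proof_irrelevance.
Qed.

Lemma list_restrict {A : Type} (P : A -> Prop) (l : list A) :
  exists l', forall a, In a l' <-> In a l /\ P a.
Proof.
  exists (filter (fun a => if excluded_middle_informative (P a) then true else false) l).
  intros a; rewrite filter_In.
  destruct (excluded_middle_informative (P a)); intuition congruence.
Qed.

Lemma list_choice {A B : Type} (R : A -> B -> Prop) (l : list A) :
  (forall a, In a l -> exists b, R a b) ->
  exists l', (forall a, In a l -> exists b, In b l' /\ R a b) /\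
             (forall b, In b l' -> exists a, In a l /\ R a b).
Proof.
  induction l as [|a l IH]; intros H.
  - exists nil; split; intros ? [].
  - destruct IH as [l' [H1 H2]]; [intros; apply H; simpl; auto|].
    destruct (H a) as [b Hb]; [simpl; auto|].
    exists (b :: l'); split.
    + intros a' [E|Ha']; [subst; exists b; simpl; auto|].
      destruct (H1 a' Ha') as [b' [? ?]]; exists b'; simpl; auto.
    + intros b' [E|Hb']; [subst; exists a; simpl; auto|].
      destruct (H2 b' Hb') as [a' [? ?]]; exists a'; simpl; auto.
Qed.

Lemma eventually_list {A : Type} (Q : A -> nat -> Prop) (l : list A) :
  (forall a, In a l -> exists m, forall n, (m <= n)%nat -> Q a n) ->
  exists n, forall a, In a l -> Q a n.
Proof.
  intros H.
  cut (exists m, forall n, (m <= n)%nat -> forall a, In a l -> Q a n).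
  { intros [m Hm]; exists m; apply Hm; auto. }
  induction l as [|a l IH]; [exists 0%nat; intros n _ a []|].
  destruct IH as [m1 H1]; [intros; apply H; simpl; auto|].
  destruct (H a) as [m2 H2]; [simpl; auto|].
  exists (Nat.max m1 m2); intros n Hn b [<-|Hb]; [apply H2|apply H1]; auto; lia.
Qed.

(** * Separation and compactness *)

Definition closure (X : TopSpace) (A : X -> Prop) (x : X) : Prop :=
  forall W, is_open X W -> W x -> exists p, W p /\ A p.

Definition t1 (X : TopSpace) : Prop := forall x : X, is_open X (fun y => y <> x).

Definition hausdorff (X : TopSpace) : Prop :=
  forall x y : X, x <> y -> exists U V, is_open X U /\ is_open X V /\
    U x /\ V y /\ forall p, ~ (U p /\ V p).

Definition perfect (X : TopSpace) : Prop :=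
  forall x : X, ~ is_open X (fun y => y = x).

Lemma open_of_nbhds (X : TopSpace) (U : X -> Prop) :
  (forall x, U x -> exists W, is_open X W /\ W x /\ forall y, W y -> U y) ->
  is_open X U.
Proof.
  intros H.
  rewrite (pred_ext U (fun x => exists W, (is_open X W /\ forall y, W y -> U y) /\ W x)).
  - apply open_union; tauto.
  - intros x; split.
    + intros Ux; destruct (H x Ux) as [W [? [? ?]]]; exists W; auto.
    + intros [W [[_ HW] Wx]]; auto.
Qed.

Lemma common_nbhd (X : TopSpace) (x : X) {A : Type} (l : list A) (R : A -> X -> Prop) :
  (forall a, In a l -> exists W, is_open X W /\ W x /\ forall p, W p -> R a p) ->
  exists W, is_open X W /\ W x /\ forall p, W p -> forall a, In a l -> R a p.
Proof.
  induction l as [|a l IH]; intros H.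
  - exists (fun _ => True); split; [apply open_full|]; split; [exact I|]; intros p _ a [].
  - destruct IH as [W1 [O1 [x1 H1]]]; [intros; apply H; simpl; auto|].
    destruct (H a) as [W2 [O2 [x2 H2]]]; [simpl; auto|].
    exists (fun p => W1 p /\ W2 p); split; [apply open_inter; auto|]; split; [auto|].
    intros p [P1 P2] b [<-|Hb]; auto.
Qed.

Lemma not_closure_nbhd (X : TopSpace) (A : X -> Prop) (x : X) :
  ~ closure X A x -> exists W, is_open X W /\ W x /\ forall p, W p -> ~ A p.
Proof.
  intros H; apply NNPP; intros N; apply H; intros W OW Wx.
  apply NNPP; intros N'; apply N; exists W; split; [auto|]; split; [auto|].
  intros p Wp Ap; apply N'; exists p; auto.
Qed.

Lemma hausdorff_t1 (X : TopSpace) : hausdorff X -> t1 X.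
Proof.
  intros HX x; apply open_of_nbhds; intros y Hy.
  destruct (HX x y) as [U [V [? [? [? [? D]]]]]]; [congruence|].
  exists V; split; [auto|]; split; [auto|]; intros p Vp E; subst; apply (D x); auto.
Qed.

Lemma continuous_injective_hausdorff (X Y : TopSpace) (f : X -> Y) :
  continuous X Y f -> (forall a b, f a = f b -> a = b) -> hausdorff Y -> hausdorff X.
Proof.
  intros Cf If HY a b Hab.
  destruct (HY (f a) (f b)) as [U [V [OU [OV [Ua [Vb D]]]]]]; [auto|].
  exists (fun x => U (f x)), (fun x => V (f x)).
  split; [apply Cf; auto|]; split; [apply Cf; auto|]; split; [auto|]; split; [auto|].
  intros p; apply D.
Qed.

Lemma subspace_incl_continuous (X : TopSpace) (P : X -> Prop) :
  continuous (subspace X P) X (@proj1_sig X P).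
Proof. intros V OV; exists V; split; [auto|intros; reflexivity]. Qed.

Lemma subspace_hausdorff (X : TopSpace) (P : X -> Prop) :
  hausdorff X -> hausdorff (subspace X P).
Proof.
  apply continuous_injective_hausdorff with (f := @proj1_sig X P).
  - apply subspace_incl_continuous.
  - intros a b; apply sig_eq.
Qed.

Lemma card_open_iff (X : TopSpace) (x : X) (V : X -> Prop) : t1 X ->
  (is_open (card X x) (fun p => V (proj1_sig p)) <-> is_open X (fun p => p <> x /\ V p)).
Proof.
  intros T; split.
  - intros [U [OU HU]].
    rewrite (pred_ext _ (fun p => p <> x /\ U p)); [apply open_inter; auto|].
    intros p; split; intros [N Hp]; (split; [exact N|]); apply (HU (exist _ p N)); exact Hp.
  - intros O; exists (fun p => p <> x /\ V p); split; [exact O|].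
    intros [p N]; simpl; tauto.
Qed.

Definition compact_in (X : TopSpace) (C : X -> Prop) : Prop :=
  forall F, open_family X F -> (forall x, C x -> exists U, F U /\ U x) ->
    exists l : list (X -> Prop), (forall U, In U l -> F U) /\
      (forall x, C x -> exists U, In U l /\ U x).

Lemma compact_in_inter_closed (X : TopSpace) (C D : X -> Prop) :
  compact_in X C -> is_closed X D -> compact_in X (fun x => C x /\ D x).
Proof.
  intros HC HD F OF CF.
  destruct (HC (fun U => F U \/ U = (fun x => ~ D x))) as [l [Hl Cl]].
  - intros U [FU| ->]; auto.
  - intros x Cx; destruct (classic (D x)) as [Dx|Nx].
    + destruct (CF x (conj Cx Dx)) as [U [? ?]]; exists U; auto.
    + exists (fun x => ~ D x); auto.
  - destruct (list_restrict F l) as [l' Hl'].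
    exists l'; split; [intros U HU; apply Hl'; exact HU|].
    intros x [Cx Dx]; destruct (Cl x Cx) as [U [HU Ux]]; exists U; split; [|exact Ux].
    apply Hl'; split; [exact HU|].
    destruct (Hl U HU) as [?|E]; [assumption|]; subst U; contradiction.
Qed.

Lemma closed_compact_in (X : TopSpace) (C : X -> Prop) :
  compact X -> is_closed X C -> compact_in X C.
Proof.
  intros HX HC; rewrite (pred_ext C (fun x => True /\ C x)) by tauto.
  apply compact_in_inter_closed; [|exact HC].
  intros F OF CF; destruct (HX F OF) as [l [? Hl]]; [intros x; apply CF; exact I|].
  exists l; auto.
Qed.

Lemma compact_in_image (X Z : TopSpace) (f : X -> Z) (C : X -> Prop) :
  (forall V, is_open Z V -> exists U, is_open X U /\ forall p, C p -> (U p <-> V (f p))) ->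
  compact_in X C -> compact_in Z (fun q => exists p, C p /\ q = f p).
Proof.
  intros Cf HC F OF CF.
  destruct (HC (fun U => is_open X U /\ exists V, F V /\ forall p, C p -> (U p <-> V (f p))))
    as [l [Hl Cl]].
  - intros U [OU _]; exact OU.
  - intros p Cp; destruct (CF (f p)) as [V [FV Vp]]; [exists p; auto|].
    destruct (Cf V (OF V FV)) as [U [OU HU]].
    exists U; split; [split; [exact OU|exists V; auto]|]; apply HU; auto.
  - destruct (list_choice (fun U V => F V /\ forall p, C p -> (U p <-> V (f p))) l)
      as [l' [H1 H2]]; [intros U HU; apply Hl; exact HU|].
    exists l'; split.
    + intros V HV; destruct (H2 V HV) as [U [_ [FV _]]]; exact FV.
    + intros q [p [Cp ->]]; destruct (Cl p Cp) as [U [HU Up]].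
      destruct (H1 U HU) as [V [HV [_ E]]]; exists V; split; [exact HV|]; apply E; auto.
Qed.

Lemma compact_in_closed (X : TopSpace) (C : X -> Prop) :
  hausdorff X -> compact_in X C -> is_closed X C.
Proof.
  intros HX HC; apply open_of_nbhds; intros x Nx.
  destruct (HC (fun U => is_open X U /\ exists W, is_open X W /\ W x /\
                          forall p, W p -> ~ U p)) as [l [Hl Cl]].
  - intros U [OU _]; exact OU.
  - intros y Cy; destruct (HX y x) as [U [W [OU [OW [Uy [Wx D]]]]]]; [congruence|].
    exists U; split; [split; [exact OU|]|exact Uy].
    exists W; split; [auto|]; split; [auto|]; intros p Wp Up; apply (D p); auto.
  - destruct (common_nbhd X x l (fun U p => ~ U p)) as [W [OW [Wx HW]]].
    + intros U HU; apply Hl; exact HU.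
    + exists W; split; [auto|]; split; [auto|]; intros p Wp Cp.
      destruct (Cl p Cp) as [U [HU Up]]; apply (HW p Wp U HU Up).
Qed.

Lemma compact_hausdorff_homeomorphic (X Z : TopSpace) (f : X -> Z) (g : Z -> X) :
  compact X -> hausdorff Z -> (forall p, g (f p) = p) -> (forall q, f (g q) = q) ->
  continuous X Z f -> homeomorphic Z X.
Proof.
  intros HX HZ gf fg Cf; exists g, f; split; [auto|]; split; [auto|]; split; [|auto].
  intros U OU.
  assert (HC : is_closed Z (fun q => exists p, ~ U p /\ q = f p)).
  { apply compact_in_closed; [exact HZ|]; apply compact_in_image.
    - intros V OV; exists (fun p => V (f p)); split; [apply Cf; auto|tauto].
    - apply closed_compact_in; [exact HX|]; unfold is_closed.
      rewrite (pred_ext _ U); [exact OU|]; intros a; split; [apply NNPP|tauto]. }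
  unfold is_closed in HC; rewrite (pred_ext _ (fun q => U (g q))) in HC; [exact HC|].
  intros q; split.
  - intros H; apply NNPP; intros N; apply H; exists (g q); auto.
  - intros H [p [Np E]]; subst; rewrite gf in H; contradiction.
Qed.

(** * Reconstruction *)

Lemma t1_of_cards (Z : TopSpace) :
  (forall z : Z, exists w1 w2, w1 <> z /\ w2 <> z /\ w1 <> w2) ->
  (forall z : Z, t1 (card Z z)) -> t1 Z.
Proof.
  intros H3 HT z; destruct (H3 z) as [w1 [w2 [N1 [N2 N12]]]].
  assert (HV : forall w, w <> z -> exists V, is_open Z V /\
                 forall y, y <> w -> (V y <-> y <> z)).
  { intros w Nw.
    destruct (HT w (exist _ z (not_eq_sym Nw))) as [V [OV EV]].
    exists V; split; [exact OV|]; intros y Ny.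
    rewrite <- (EV (exist _ y Ny)); split; intros N E; apply N.
    - apply sig_eq; exact E.
    - injection E; auto. }
  destruct (HV w1 N1) as [V1 [O1 E1]], (HV w2 N2) as [V2 [O2 E2]].
  apply open_of_nbhds; intros y Ny.
  destruct (classic (y = w1)) as [-> |M].
  - exists V2; split; [auto|]; split; [apply E2; auto|].
    intros p Vp ->; apply E2 in Vp; auto.
  - exists V1; split; [auto|]; split; [apply E1; auto|].
    intros p Vp ->; apply E1 in Vp; auto.
Qed.

Lemma hausdorff_of_cards (Z : TopSpace) :
  (forall z : Z, exists w1 w2, w1 <> z /\ w2 <> z /\ w1 <> w2) ->
  t1 Z -> (forall z : Z, hausdorff (card Z z)) -> hausdorff Z.
Proof.
  intros H3 HT HH a b Nab; destruct (H3 a) as [w1 [w2 [N1 [N2 N12]]]].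
  assert (Hw : exists w, a <> w /\ b <> w).
  { destruct (classic (b = w1)); [exists w2|exists w1]; split; congruence. }
  destruct Hw as [w [Na Nb]].
  destruct (HH w (exist _ a Na) (exist _ b Nb))
    as [U [V [[U' [OU EU]] [[V' [OV EV]] [Ua [Vb D]]]]]].
  { intros E; injection E; auto. }
  exists (fun y => y <> w /\ U' y), (fun y => y <> w /\ V' y).
  split; [apply open_inter; auto|]; split; [apply open_inter; auto|].
  split; [split; [auto|]; apply (EU (exist _ a Na)), Ua|].
  split; [split; [auto|]; apply (EV (exist _ b Nb)), Vb|].
  intros p [[N Up] [_ Vp]]; apply (D (exist _ p N)); split; [apply EU|apply EV]; assumption.
Qed.

(* A homeomorphism between [X \ {x}] and [Z \ {z}], extended by [x |-> z]. *)
Record punctured_homeo (X Z : TopSpace) (x : X) (z : Z) (f : X -> Z) (g : Z -> X) : Prop := {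
  ph_fx : f x = z;
  ph_gf : forall p, g (f p) = p;
  ph_fg : forall q, f (g q) = q;
  ph_f : forall V, is_open Z V -> is_open X (fun p => p <> x /\ V (f p));
  ph_g : forall U, is_open X U -> is_open Z (fun q => q <> z /\ U (g q))
}.

Definition extend_card (X Z : TopSpace) (x : X) (z : Z) (h : card X x -> card Z z) (p : X) : Z :=
  match excluded_middle_informative (p = x) with
  | left _ => z
  | right n => proj1_sig (h (exist _ p n))
  end.

Lemma extend_card_at (X Z : TopSpace) (x : X) (z : Z) (h : card X x -> card Z z) :
  extend_card X Z x z h x = z.
Proof. unfold extend_card; destruct excluded_middle_informative; congruence. Qed.

Lemma extend_card_off (X Z : TopSpace) (x : X) (z : Z) (h : card X x -> card Z z)
  (p : card X x) : extend_card X Z x z h (proj1_sig p) = proj1_sig (h p).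
Proof.
  unfold extend_card; destruct excluded_middle_informative as [E|N].
  - destruct (proj2_sig p E).
  - do 2 f_equal; apply sig_eq; reflexivity.
Qed.

Lemma extend_card_cancel (X Z : TopSpace) (x : X) (z : Z)
  (h : card X x -> card Z z) (h' : card Z z -> card X x) :
  (forall p, h' (h p) = p) ->
  forall p, extend_card Z X z x h' (extend_card X Z x z h p) = p.
Proof.
  intros H p; destruct (classic (p = x)) as [-> |N].
  - rewrite extend_card_at; apply extend_card_at.
  - change p with (proj1_sig (exist (fun p => p <> x) p N)).
    rewrite (extend_card_off X Z x z h (exist _ p N)), extend_card_off, H; reflexivity.
Qed.

Lemma extend_card_open (X Z : TopSpace) (x : X) (z : Z) (h : card X x -> card Z z) :
  t1 X -> continuous (card X x) (card Z z) h ->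
  forall V, is_open Z V -> is_open X (fun p => p <> x /\ V (extend_card X Z x z h p)).
Proof.
  intros T C V OV; apply card_open_iff; [exact T|].
  rewrite (pred_ext _ (fun p => V (proj1_sig (h p)))).
  - apply (C (fun q => V (proj1_sig q))).
    apply (subspace_incl_continuous Z (fun q => q <> z) V OV).
  - intros p; rewrite extend_card_off; reflexivity.
Qed.

Lemma punctured_homeo_of_card (X Z : TopSpace) (x : X) (z : Z) :
  t1 X -> t1 Z -> homeomorphic (card Z z) (card X x) ->
  exists f g, punctured_homeo X Z x z f g.
Proof.
  intros TX TZ [h [h' [E1 [E2 [C1 C2]]]]].
  exists (extend_card X Z x z h'), (extend_card Z X z x h); split.
  - apply extend_card_at.
  - apply extend_card_cancel; auto.
  - apply extend_card_cancel; auto.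
  - apply extend_card_open; auto.
  - apply extend_card_open; auto.
Qed.

Lemma punctured_compact_image (X Z : TopSpace) (x : X) (z : Z) f g (C : X -> Prop) :
  punctured_homeo X Z x z f g -> compact X -> is_closed X C -> ~ C x ->
  compact_in Z (fun q => C (g q)).
Proof.
  intros H HX HC Nx.
  rewrite (pred_ext _ (fun q => exists p, C p /\ q = f p)).
  - apply compact_in_image; [|apply closed_compact_in; auto].
    intros V OV; exists (fun p => p <> x /\ V (f p)); split; [apply (ph_f _ _ _ _ _ _ H V OV)|].
    intros p Cp; split; [tauto|]; intros Vp; split; [congruence|exact Vp].
  - intros q; split.
    + intros Cq; exists (g q); rewrite (ph_fg _ _ _ _ _ _ H); auto.
    + intros [p [Cp ->]]; rewrite (ph_gf _ _ _ _ _ _ H); auto.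
Qed.

Definition locally_unsplit (X : TopSpace) : Prop :=
  forall (x : X) N U V, is_open X N -> N x -> is_open X U -> is_open X V ->
    closure X U x -> closure X V x ->
    exists p, N p /\ p <> x /\ closure X U p /\ closure X V p.

Lemma perfect_two_points (X : TopSpace) (x : X) : hausdorff X -> perfect X ->
  exists p q, p <> x /\ q <> x /\ p <> q.
Proof.
  intros HX PX.
  assert (Hp : forall P y, is_open X P -> P y -> exists p, P p /\ p <> y).
  { intros P y OP Py; apply NNPP; intros N; apply (PX y).
    rewrite (pred_ext _ P); [exact OP|]; intros a; split; [congruence|].
    intros Pa; apply NNPP; intros Na; apply N; exists a; auto. }
  destruct (Hp (fun _ => True) x) as [p [_ Np]]; [apply open_full|auto|].
  destruct (HX p x Np) as [P [Q [OP [_ [Pp [Qx D]]]]]].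
  destruct (Hp P p OP Pp) as [q [Pq Nq]].
  exists p, q; split; [auto|]; split; [|auto]; intros ->; apply (D x); auto.
Qed.

Lemma punctured_homeo_extends (X Z : TopSpace) (x : X) (z : Z) f g
  (U C : Z -> Prop) :
  compact X -> hausdorff X -> locally_unsplit X -> hausdorff Z -> perfect Z ->
  punctured_homeo X Z x z f g ->
  is_open Z U -> U z -> (forall q, U q -> C q) -> compact_in Z C ->
  exists N, is_open X N /\ N x /\ forall p, N p -> U (f p).
Proof.
  intros HX TX LX TZ PZ H OU Uz UC HC.
  pose proof (ph_fx _ _ _ _ _ _ H) as fx.
  pose proof (ph_gf _ _ _ _ _ _ H) as gf.
  pose proof (ph_fg _ _ _ _ _ _ H) as fg.
  set (O := fun p => p <> x /\ U (f p)).
  set (W := fun p => p <> x /\ ~ C (f p)).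
  assert (OO : is_open X O) by (apply (ph_f _ _ _ _ _ _ H); auto).
  assert (CC : is_closed Z C) by (apply compact_in_closed; auto).
  assert (OW : is_open X W) by (apply (ph_f _ _ _ _ _ _ H (fun q => ~ C q) CC)).
  assert (clO : closure X O x).
  { apply NNPP; intros N; apply not_closure_nbhd in N.
    destruct N as [N [ON [Nx HN]]]; apply (PZ z).
    assert (K : is_closed Z (fun q => ~ N (g q))).
    { apply compact_in_closed; [exact TZ|].
      apply (punctured_compact_image X Z x z f g (fun p => ~ N p)); auto.
      unfold is_closed; rewrite (pred_ext _ N); [auto|]; intros a; split; [apply NNPP|tauto]. }
    unfold is_closed in K.
    rewrite (pred_ext _ (fun q => U q /\ ~ ~ N (g q))); [apply open_inter; auto|].
    intros q; split.
    - intros ->; split; [auto|]; rewrite <- fx, gf; tauto.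
    - intros [Uq Nq]; apply NNPP; intros M; apply Nq; intros Nq'.
      apply (HN (g q) Nq'); split; [|rewrite fg; exact Uq].
      intros E; apply M; rewrite <- (fg q), E; exact fx. }
  assert (CB : is_closed X (fun p => C (f p) /\ ~ U (f p))).
  { apply compact_in_closed; [exact TX|].
    rewrite (pred_ext _ (fun p => exists q, (C q /\ ~ U q) /\ p = g q)).
    - apply compact_in_image.
      + intros V OV; exists (fun q => q <> z /\ V (g q)); split; [apply (ph_g _ _ _ _ _ _ H); auto|].
        intros q [_ Nq]; split; [tauto|]; intros Vq; split; [congruence|exact Vq].
      + apply compact_in_inter_closed; [exact HC|].
        unfold is_closed; rewrite (pred_ext _ U); [exact OU|].
        intros q; split; [apply NNPP|tauto].
    - intros p; split.
      + intros Hp; exists (f p); rewrite gf; auto.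
      + intros [q [Hq ->]]; rewrite fg; exact Hq. }
  unfold is_closed in CB.
  assert (nW : ~ closure X W x).
  { intros clW.
    destruct (LX x _ O W CB) as [p [Np [px [pO pW]]]]; auto; [rewrite fx; tauto|].
    destruct (classic (U (f p))) as [Up|NU].
    - destruct (pW O OO) as [r [[_ Ur] [_ Cr]]]; [split; auto|]; auto.
    - destruct (pO W OW) as [r [[_ Cr] [_ Ur]]]; [split; [auto|]; tauto|]; auto. }
  apply not_closure_nbhd in nW; destruct nW as [N [ON [Nx HN]]].
  exists (fun p => N p /\ ~ (C (f p) /\ ~ U (f p))).
  split; [apply open_inter; auto|]; split; [split; [auto|]; rewrite fx; tauto|].
  intros p [Np Hp]; apply NNPP; intros NU.
  apply (HN p Np); split; [intros ->; rewrite fx in NU; auto|]; tauto.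
Qed.

Lemma reconstructible_of_locally_unsplit (X : TopSpace) (x0 : X) :
  compact X -> hausdorff X -> perfect X -> locally_unsplit X -> reconstructible X.
Proof.
  intros HX TX PX LX Z [D1 D2].
  assert (HH : forall z : Z, hausdorff (card Z z)).
  { intros z; destruct (D1 z) as [x [h [h' [E1 [E2 [C1 C2]]]]]].
    apply (continuous_injective_hausdorff _ _ h C1); [|apply subspace_hausdorff; exact TX].
    intros a b E; rewrite <- (E1 a), <- (E1 b), E; reflexivity. }
  assert (H3 : forall z : Z, exists w1 w2, w1 <> z /\ w2 <> z /\ w1 <> w2).
  { intros z; destruct (D1 z) as [x [h [h' [E1 [E2 [C1 C2]]]]]].
    destruct (perfect_two_points X x TX PX) as [p [q [Np [Nq Npq]]]].
    exists (proj1_sig (h' (exist _ p Np))), (proj1_sig (h' (exist _ q Nq))).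
    split; [apply proj2_sig|]; split; [apply proj2_sig|].
    intros E; apply sig_eq, (f_equal h) in E; rewrite !E2 in E; injection E; auto. }
  assert (T1Z : t1 Z) by (apply t1_of_cards; [exact H3|]; intros z; apply hausdorff_t1, HH).
  assert (TZ : hausdorff Z) by (apply hausdorff_of_cards; auto).
  assert (T1X : t1 X) by (apply hausdorff_t1; auto).
  assert (PH : forall z : Z, exists x f g, punctured_homeo X Z x z f g).
  { intros z; destruct (D1 z) as [x Hx]; exists x; apply punctured_homeo_of_card; auto. }
  assert (PZ : perfect Z).
  { intros z Oz; destruct (H3 z) as [w [_ [Nw _]]].
    destruct (PH w) as [x [f [g H]]].
    apply (PX (g z)).
    rewrite (pred_ext _ (fun p => p <> x /\ f p = z)); [apply (ph_f _ _ _ _ _ _ H _ Oz)|].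
    pose proof (ph_fx _ _ _ _ _ _ H); pose proof (ph_gf _ _ _ _ _ _ H);
      pose proof (ph_fg _ _ _ _ _ _ H).
    intros p; split; [intros ->; split; [|auto]|intros [_ <-]; auto].
    congruence. }
  assert (LC : forall z : Z, exists U C, is_open Z U /\ U z /\ (forall q, U q -> C q) /\
                compact_in Z C).
  { intros z; destruct (H3 z) as [w [_ [Nw _]]].
    destruct (PH w) as [x [f [g H]]].
    assert (Nz : g z <> x).
    { pose proof (ph_fx _ _ _ _ _ _ H); pose proof (ph_fg _ _ _ _ _ _ H); congruence. }
    destruct (TX _ _ Nz) as [P [Q [OP [OQ [Pz [Qx D]]]]]].
    exists (fun q => q <> w /\ P (g q)), (fun q => ~ Q (g q)).
    split; [apply (ph_g _ _ _ _ _ _ H); auto|]; split; [auto|].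
    split; [intros q [_ Pq] Qq; apply (D (g q)); auto|].
    apply (punctured_compact_image X Z x w f g (fun p => ~ Q p)); auto.
    unfold is_closed; rewrite (pred_ext _ Q); [auto|]; intros a; split; [apply NNPP|tauto]. }
  destruct (D2 x0) as [z _].
  destruct (PH z) as [x [f [g H]]].
  apply (compact_hausdorff_homeomorphic X Z f g);
    [auto|auto|apply (ph_gf _ _ _ _ _ _ H)|apply (ph_fg _ _ _ _ _ _ H)|].
  intros V OV; apply open_of_nbhds; intros p Vp.
  destruct (classic (p = x)) as [-> |Np].
  - destruct (LC z) as [U [C [OU [Uz [UC HC]]]]].
    rewrite (ph_fx _ _ _ _ _ _ H) in Vp.
    destruct (punctured_homeo_extends X Z x z f g (fun q => U q /\ V q) C)
      as [N [ON [Nx HN]]]; auto.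
    + apply open_inter; auto.
    + intros q [Uq _]; auto.
    + exists N; split; [auto|]; split; [auto|]; apply HN.
  - exists (fun p => p <> x /\ V (f p)); split; [apply (ph_f _ _ _ _ _ _ H); auto|].
    split; [auto|]; tauto.
Qed.

(** * Products *)

Lemma tychonoff (K : Type) (Y : TopSpace) : compact Y -> compact (product_space K Y).
Proof.
  intros HY F OF CF; apply NNPP; intros Hno.
  set (bad := fun G : ((K -> Y) -> Prop) -> Prop =>
    forall l, (forall U, In U l -> F U \/ G U) -> ~ forall p, exists U, In U l /\ U p).
  destruct (@classical_sets.Zorn_bigcup ((K -> Y) -> Prop) bad) as [M [BM MM]].
  { intros T HT Tot l Hl Cl.
    assert (HG : (forall U, In U l -> F U) \/
                 exists G, T G /\ forall U, In U l -> F U \/ G U).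
    { clear Cl; induction l as [|U l IH]; [left; intros U []|].
      assert (HU : F U \/ exists G, T G /\ G U).
      { destruct (Hl U) as [?|[G TG GU]]; [simpl; auto|auto|right; exists G; auto]. }
      destruct IH as [IH|[G [TG IH]]]; [intros; apply Hl; simpl; auto| |].
      - destruct HU as [HU|[G [TG GU]]].
        + left; intros V [<-|HV]; auto.
        + right; exists G; split; [exact TG|]; intros V [<-|HV]; auto.
      - right; destruct HU as [HU|[G' [TG' GU]]].
        + exists G; split; [exact TG|]; intros V [<-|HV]; auto.
        + destruct (Tot G G' TG TG') as [S|S].
          * exists G'; split; [exact TG'|]; intros V [<-|HV]; auto.
            destruct (IH V HV); auto.
          * exists G; split; [exact TG|]; intros V [<-|HV]; auto. }
    destruct HG as [HG|[G [TG HG]]].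
    - apply Hno; exists l; auto.
    - apply (HT G TG l HG Cl). }
  set (cyl := fun (k : K) (V : Y -> Prop) (p : K -> Y) => V (p k)).
  assert (maxM : forall U, ~ (F U \/ M U) -> exists l,
            (forall V, In V l -> F V \/ M V) /\
            forall p, U p \/ exists V, In V l /\ V p).
  { intros U NU; apply NNPP; intros N.
    apply (MM (fun V => M V \/ V = U)).
    - split; [intros V MV; left; exact MV|].
      intros S; apply NU; right; apply S; right; reflexivity.
    - intros l Hl Cl; apply N.
      destruct (list_restrict (fun V => F V \/ M V) l) as [l' Hl'].
      exists l'; split; [intros V HV; apply Hl'; exact HV|].
      intros p; destruct (Cl p) as [V [HV Vp]].
      destruct (classic (F V \/ M V)) as [FM|NFM].
      + right; exists V; split; [apply Hl'; auto|exact Vp].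
      + left; destruct (Hl V HV) as [?|[?| ->]]; tauto. }
  assert (pt : forall k, exists y, forall V, is_open Y V -> F (cyl k V) \/ M (cyl k V) -> ~ V y).
  { intros k; apply NNPP; intros N.
    destruct (HY (fun V => is_open Y V /\ (F (cyl k V) \/ M (cyl k V)))) as [l [Hl Cl]].
    - intros V [OV _]; exact OV.
    - intros y; apply NNPP; intros N'; apply N; exists y; intros V OV MV Vy.
      apply N'; exists V; auto.
    - apply (BM (map (cyl k) l)).
      + intros U HU; apply in_map_iff in HU; destruct HU as [V [<- HV]]; apply Hl, HV.
      + intros p; destruct (Cl (p k)) as [V [HV Vp]]; exists (cyl k V).
        split; [apply in_map; exact HV|exact Vp]. }
  set (p := fun k => proj1_sig (constructive_indefinite_description _ (pt k))).
  assert (Hp : forall k V, is_open Y V -> V (p k) -> ~ (F (cyl k V) \/ M (cyl k V))).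
  { intros k V OV Vp MV; unfold p in Vp.
    destruct (constructive_indefinite_description _ (pt k)) as [y Hy]; apply (Hy V); auto. }
  destruct (CF p) as [U [FU Up]].
  destruct (OF U FU p Up) as [l [Ol [pl Ul]]].
  assert (HL : exists L, (forall V, In V L -> F V \/ M V) /\
      forall q, (forall a, In a l -> snd a (q (fst a))) \/ exists V, In V L /\ V q).
  { clear Ul; induction l as [|a l IH].
    - exists nil; split; [intros V []|]; intros q; left; intros a [].
    - destruct IH as [L1 [H1 C1]]; [intros; apply Ol; simpl; auto|intros; apply pl; simpl; auto|].
      destruct (maxM (cyl (fst a) (snd a))) as [L2 [H2 C2]];
        [apply Hp; [apply Ol|apply pl]; simpl; auto|].
      exists (L1 ++ L2); split.
      + intros V HV; apply in_app_or in HV; destruct HV; auto.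
      + intros q; destruct (C1 q) as [Q1|[V [? ?]]];
          [|right; exists V; split; [apply in_or_app|]; auto].
        destruct (C2 q) as [Q2|[V [? ?]]];
          [|right; exists V; split; [apply in_or_app|]; auto].
        left; intros b [<-|Hb]; auto. }
  destruct HL as [L [HL CL]].
  apply (BM (U :: L)).
  - intros V [<-|HV]; auto.
  - intros q; destruct (CL q) as [Q|[V [? ?]]].
    + exists U; split; [simpl; auto|]; apply Ul; exact Q.
    + exists V; simpl; auto.
Qed.

Lemma cylinder_open (K : Type) (Y : TopSpace) (k : K) (V : Y -> Prop) :
  is_open Y V -> is_open (product_space K Y) (fun p => V (p k)).
Proof.
  intros OV x Vx; exists ((k, V) :: nil); split; [|split].
  - intros a [<-|[]]; exact OV.
  - intros a [<-|[]]; exact Vx.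
  - intros y Hy; apply (Hy (k, V)); simpl; auto.
Qed.

Lemma prod_open_support (K : Type) (Y : TopSpace) (U : (K -> Y) -> Prop) (x : K -> Y) :
  is_open (product_space K Y) U -> U x ->
  exists F : list K, forall p, (forall i, In i F -> p i = x i) -> U p.
Proof.
  intros OU Ux; destruct (OU x Ux) as [l [_ [xl Ul]]].
  exists (map fst l); intros p Hp; apply Ul; intros a Ha.
  rewrite Hp; [auto|apply in_map; exact Ha].
Qed.

Lemma prod_neq {K Y : Type} (p q : K -> Y) : p <> q -> exists i, p i <> q i.
Proof.
  intros N; apply NNPP; intros H; apply N; apply functional_extensionality.
  intros i; apply NNPP; intros Hi; apply H; exists i; exact Hi.
Qed.

Lemma product_hausdorff (K : Type) (Y : TopSpace) :
  hausdorff Y -> hausdorff (product_space K Y).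
Proof.
  intros HY p q N; destruct (prod_neq p q N) as [i Ni].
  destruct (HY _ _ Ni) as [U [V [OU [OV [Up [Vq D]]]]]].
  exists (fun p => U (p i)), (fun p => V (p i)).
  split; [apply cylinder_open; auto|]; split; [apply cylinder_open; auto|].
  split; [auto|]; split; [auto|]; intros r; apply D.
Qed.

Definition first_countable (Y : TopSpace) : Prop :=
  forall y : Y, exists b : nat -> Y -> Prop,
    (forall n, is_open Y (b n) /\ b n y) /\
    forall V, is_open Y V -> V y -> exists m, forall n, (m <= n)%nat -> forall u, b n u -> V u.

Lemma uncountable_escapes (K : Type) (L : nat -> list K) :
  uncountable K -> exists k, forall n, ~ In k (L n).
Proof.
  intros HK; apply NNPP; intros N.
  assert (H : forall k, exists c : nat * nat, nth_error (L (fst c)) (snd c) = Some k).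
  { intros k; apply NNPP; intros Nk; apply N; exists k; intros n Hn.
    destruct (In_nth_error _ _ Hn) as [m Hm]; apply Nk; exists (n, m); exact Hm. }
  set (c := fun k => proj1_sig (constructive_indefinite_description _ (H k))).
  assert (Hc : forall k, nth_error (L (fst (c k))) (snd (c k)) = Some k).
  { intros k; exact (proj2_sig (constructive_indefinite_description _ (H k))). }
  apply HK; exists (fun k => Cantor.to_nat (c k)); intros a b E.
  apply Cantor.to_nat_inj in E; pose proof (Hc a) as Ha.
  rewrite E, Hc in Ha; congruence.
Qed.

Lemma uncountable_fresh (K : Type) (F : list K) : uncountable K -> exists k, ~ In k F.
Proof.
  intros HK; destruct (uncountable_escapes K (fun _ => F) HK) as [k Hk].
  exists k; apply (Hk 0%nat).
Qed.

Lemma uncountable_sequence (K : Type) : uncountable K ->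
  exists L : nat -> list K, forall F, exists n k, In k (L n) /\ ~ In k F.
Proof.
  intros HK.
  set (fresh := fun F : list K =>
    proj1_sig (constructive_indefinite_description _ (uncountable_fresh K F HK))).
  assert (Hf : forall F, ~ In (fresh F) F).
  { intros F; exact (proj2_sig (constructive_indefinite_description _ (uncountable_fresh K F HK))). }
  set (L := nat_rect (fun _ => list K) nil (fun _ F => fresh F :: F)).
  assert (HL : forall n, NoDup (L n) /\ length (L n) = n).
  { induction n as [|n [N E]]; simpl; [split; [constructor|reflexivity]|].
    split; [constructor; auto|congruence]. }
  exists L; intros F; exists (S (length F)).
  apply NNPP; intros N.
  destruct (HL (S (length F))) as [ND E].
  assert (I : incl (L (S (length F))) F).
  { intros k Hk; apply NNPP; intros Nk; apply N; exists k; auto. }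
  pose proof (NoDup_incl_length ND I); lia.
Qed.

Lemma compact_lindelof (X : TopSpace) : compact X -> lindelof X.
Proof.
  intros HX F OF CF; destruct (HX F OF CF) as [l [Hl Cl]].
  exists (fun U => In U l); split; [exact Hl|]; split; [|exact Cl].
  exists (fun n => nth n l (fun _ => True)); intros U HU.
  destruct (In_nth l U (fun _ => True) HU) as [n [_ E]]; exists n; exact E.
Qed.

Section Spikes.
Variables (K : Type) (Y : TopSpace) (alt : Y -> Y).
Hypotheses (HK : uncountable K) (HY : hausdorff Y) (Halt : forall y, alt y <> y).

Definition spike (x : K -> Y) (k : K) : K -> Y :=
  fun i => if excluded_middle_informative (i = k) then alt (x i) else x i.

Lemma spike_at x k : spike x k k = alt (x k).
Proof. unfold spike; destruct excluded_middle_informative; congruence. Qed.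

Lemma spike_off x k i : i <> k -> spike x k i = x i.
Proof. unfold spike; destruct excluded_middle_informative; congruence. Qed.

Lemma spike_support x k i : spike x k i <> x i -> i = k.
Proof. intros N; apply NNPP; intros M; apply N, spike_off, M. Qed.

Lemma spike_neq x k : spike x k <> x.
Proof. intros E; apply (Halt (x k)); rewrite <- spike_at, E; reflexivity. Qed.

Lemma spike_inj x j k : spike x j = spike x k -> j = k.
Proof.
  intros E; apply (spike_support x k); rewrite <- E, spike_at; apply Halt.
Qed.

Lemma spike_in_nbhd (x : K -> Y) (W : (K -> Y) -> Prop) :
  is_open (product_space K Y) W -> W x -> exists F, forall k, ~ In k F -> W (spike x k).
Proof.
  intros OW Wx; destruct (prod_open_support K Y W x OW Wx) as [F HF].
  exists F; intros k Nk; apply HF; intros i Hi; apply spike_off; congruence.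
Qed.

Lemma product_perfect : perfect (product_space K Y).
Proof.
  intros x O; destruct (spike_in_nbhd x _ O eq_refl) as [F HF].
  destruct (uncountable_fresh K F HK) as [k Nk].
  apply (spike_neq x k); auto.
Qed.

(* Choose [a n] in [U], tending to [x] on all coordinates of the countable set
   [S] that supports the basic neighbourhoods of the [a n] inside [U].  For [k]
   outside [S], replacing [a n] by [spike x k] outside its own finite support
   gives points of [U] converging to [spike x k]. *)
Lemma closure_spikes (x : K -> Y) (U : (K -> Y) -> Prop) :
  first_countable Y -> is_open (product_space K Y) U -> closure (product_space K Y) U x ->
  exists L : nat -> list K, forall k, (forall n, ~ In k (L n)) ->
    closure (product_space K Y) U (spike x k).
Proof.
  intros FC OU Ux.
  set (b := fun y => proj1_sig (constructive_indefinite_description _ (FC y))).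
  assert (Hb : forall y, (forall n, is_open Y (b y n) /\ b y n y) /\
    forall V, is_open Y V -> V y ->
      exists m, forall n, (m <= n)%nat -> forall u, b y n u -> V u).
  { intros y; exact (proj2_sig (constructive_indefinite_description _ (FC y))). }
  assert (St : forall (S : list K) n, exists c : (K -> Y) * list K,
     (forall i, In i S -> b (x i) n (fst c i)) /\
     forall p, (forall i, In i (snd c) -> p i = fst c i) -> U p).
  { intros S n.
    destruct (common_nbhd (product_space K Y) x S (fun i p => b (x i) n (p i)))
      as [W [OW [Wx HW]]].
    - intros i _; exists (fun p => b (x i) n (p i)).
      split; [apply cylinder_open, Hb|]; split; [apply Hb|auto].
    - destruct (Ux W OW Wx) as [a [Wa Ua]].
      destruct (prod_open_support K Y U a OU Ua) as [F HF].
      exists (a, F); split; [apply HW; exact Wa|exact HF]. }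
  set (step := fun S n => proj1_sig (constructive_indefinite_description _ (St S n))).
  assert (Hs : forall S n, (forall i, In i S -> b (x i) n (fst (step S n) i)) /\
     forall p, (forall i, In i (snd (step S n)) -> p i = fst (step S n) i) -> U p).
  { intros S n; exact (proj2_sig (constructive_indefinite_description _ (St S n))). }
  set (S := nat_rect (fun _ => list K) nil (fun n F => F ++ snd (step F n))).
  assert (S_mono : forall m n i, (m <= n)%nat -> In i (S m) -> In i (S n)).
  { intros m n i Hmn Hi; induction Hmn; [exact Hi|simpl; apply in_or_app; auto]. }
  set (a := fun n => fst (step (S n) n)).
  set (F := fun n => snd (step (S n) n)).
  exists S; intros k Hk W OW Wk.
  destruct (OW _ Wk) as [l [Ol [kl Wl]]].
  set (p := fun n i => if excluded_middle_informative (In i (F n)) then a n i else spike x k i).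
  destruct (eventually_list (fun c n => snd c (p n (fst c))) l) as [n Hn].
  - intros [i V] Hc; specialize (Ol _ Hc); specialize (kl _ Hc); cbn [fst snd] in *.
    destruct (classic (exists m, In i (S m))) as [[m Hm]|N].
    + rewrite spike_off in kl by (intros ->; apply (Hk m Hm)).
      destruct (proj2 (Hb (x i)) V Ol kl) as [m' Hm'].
      exists (Nat.max m m'); intros n Hn; unfold p; destruct excluded_middle_informative.
      * apply (Hm' n); [lia|]; apply (proj1 (Hs (S n) n)); apply (S_mono m); [lia|exact Hm].
      * rewrite spike_off by (intros ->; apply (Hk m Hm)); exact kl.
    + exists 0%nat; intros n _; unfold p; destruct excluded_middle_informative as [E|_].
      * destruct N; exists (Datatypes.S n); simpl; apply in_or_app; right; exact E.
      * exact kl.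
  - exists (p n); split; [apply Wl; exact Hn|].
    apply (proj2 (Hs (S n) n)); intros i Hi; unfold p.
    destruct excluded_middle_informative; [reflexivity|contradiction].
Qed.

Lemma product_locally_unsplit : first_countable Y -> locally_unsplit (product_space K Y).
Proof.
  intros FC x N U V ON Nx OU OV cU cV.
  destruct (closure_spikes x U FC OU cU) as [L1 H1].
  destruct (closure_spikes x V FC OV cV) as [L2 H2].
  destruct (spike_in_nbhd x N ON Nx) as [F HF].
  destruct (uncountable_escapes K (fun n => F ++ L1 n ++ L2 n) HK) as [k Hk].
  exists (spike x k); split; [|split; [apply spike_neq|split]].
  - apply HF; intros Hi; apply (Hk 0%nat), in_or_app; auto.
  - apply H1; intros n Hi; apply (Hk n), in_or_app; right; apply in_or_app; auto.
  - apply H2; intros n Hi; apply (Hk n), in_or_app; right; apply in_or_app; auto.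
Qed.

Lemma spikes_complement_open (x : K -> Y) (J : K -> Prop) :
  is_open (product_space K Y) (fun p => p <> x /\ ~ exists k, J k /\ p = spike x k).
Proof.
  pose proof (hausdorff_t1 Y HY) as T.
  apply open_of_nbhds; intros p [Np NJ].
  destruct (prod_neq p x Np) as [i Hi].
  destruct (classic (p = spike x i)) as [E|N].
  - exists (fun q => q i <> x i); split; [exact (cylinder_open K Y i _ (T (x i)))|]; split; [exact Hi|].
    intros q Hq; split; [congruence|]; intros [k [Jk ->]].
    apply NJ; exists k; split; [exact Jk|].
    rewrite <- (spike_support x k i Hq); exact E.
  - destruct (prod_neq p _ N) as [j Hj].
    exists (fun q => q i <> x i /\ q j <> spike x i j).
    split; [apply open_inter|].
    { exact (cylinder_open K Y i _ (T (x i))). }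
    { exact (cylinder_open K Y j _ (T (spike x i j))). }
    split; [auto|]; intros q [Hq Hq']; split; [congruence|]; intros [k [_ ->]].
    rewrite (spike_support x k i Hq) in Hq'; congruence.
Qed.

Definition card_spike (x : K -> Y) (k : K) : card (product_space K Y) x :=
  exist _ (spike x k) (spike_neq x k).

Lemma card_spikes_closed (x : K -> Y) (J : K -> Prop) :
  is_closed (card (product_space K Y) x) (fun p => exists k, J k /\ p = card_spike x k).
Proof.
  exists (fun p => p <> x /\ ~ exists k, J k /\ p = spike x k).
  split; [apply spikes_complement_open|].
  intros [p Np]; simpl; split.
  - intros H; split; [exact Np|]; intros [k [Jk E]]; apply H; exists k; split; [exact Jk|].
    apply sig_eq; exact E.
  - intros [_ H] [k [Jk E]]; apply H; exists k; split; [exact Jk|]; injection E; auto.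
Qed.

Lemma card_closure_spikes (x : K -> Y) (L : nat -> list K)
  (U : card (product_space K Y) x -> Prop) :
  first_countable Y -> (forall F, exists n k, In k (L n) /\ ~ In k F) ->
  is_open (card (product_space K Y) x) U ->
  (forall n k, In k (L n) -> U (card_spike x k)) ->
  exists k, (forall n, ~ In k (L n)) /\
    closure (card (product_space K Y) x) U (card_spike x k).
Proof.
  intros FC HL [U' [OU EU]] LU.
  assert (T : is_open (product_space K Y) (fun p => p <> x)).
  { apply hausdorff_t1, product_hausdorff, HY. }
  set (U0 := fun p => p <> x /\ U' p).
  assert (O0 : is_open (product_space K Y) U0) by (apply open_inter; auto).
  assert (C0 : closure (product_space K Y) U0 x).
  { intros W OW Wx; destruct (spike_in_nbhd x W OW Wx) as [F HF].
    destruct (HL F) as [n [k [Hk Nk]]].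
    exists (spike x k); split; [auto|]; split; [apply spike_neq|].
    apply (EU (card_spike x k)), (LU n), Hk. }
  destruct (closure_spikes x U0 FC O0 C0) as [L' HL'].
  destruct (uncountable_escapes K (fun n => L n ++ L' n) HK) as [k Hk].
  exists k; split.
  - intros n Hn; apply (Hk n), in_or_app; auto.
  - intros W [W' [OW EW]] Wk.
    destruct (HL' k) with (W := W') as [p [Wp [Np Up]]].
    + intros n Hn; apply (Hk n), in_or_app; auto.
    + exact OW.
    + apply (EW (card_spike x k)), Wk.
    + exists (exist _ p Np); split; [apply EW|apply EU]; assumption.
Qed.

Lemma product_card_not_lindelof (x : K -> Y) : ~ lindelof (card (product_space K Y) x).
Proof.
  intros HL.
  set (off := fun k (p : card (product_space K Y) x) => proj1_sig p k <> x k).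
  destruct (HL (fun U => exists k, U = off k)) as [G [GF [[e He] CG]]].
  - intros U [k ->]; exists (fun p => p k <> x k).
    split; [|reflexivity].
    exact (cylinder_open K Y k _ (hausdorff_t1 Y HY (x k))).
  - intros [p Np]; destruct (prod_neq p x Np) as [k Hk].
    exists (off k); split; [exists k; reflexivity|exact Hk].
  - assert (HS : forall n, exists S : list K,
              (exists k, e n = off k) -> exists k, In k S /\ e n = off k).
    { intros n; destruct (classic (exists k, e n = off k)) as [[k Hk]|N].
      - exists (k :: nil); intros _; exists k; simpl; auto.
      - exists nil; contradiction. }
    set (S := fun n => proj1_sig (constructive_indefinite_description _ (HS n))).
    destruct (uncountable_escapes K S HK) as [k Nk].
    destruct (CG (card_spike x k)) as [U [GU Uk]].
    destruct (GF U GU) as [j Ej].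
    destruct (He U GU) as [n En].
    destruct (proj2_sig (constructive_indefinite_description _ (HS n))) as [i [Hi Ei]].
    + exists j; congruence.
    + apply (Nk n); assert (i = k) as <-; [|exact Hi].
      apply (spike_support x k i).
      rewrite <- En, Ei in Uk; exact Uk.
Qed.

Lemma product_card_not_normal (x : K -> Y) :
  first_countable Y -> ~ normal (card (product_space K Y) x).
Proof.
  intros FC HN; destruct (uncountable_sequence K HK) as [L HL].
  set (J := fun k => exists n, In k (L n)).
  destruct (HN (fun p => exists k, J k /\ p = card_spike x k)
               (fun p => exists k, ~ J k /\ p = card_spike x k))
    as [U [V [OU [OV [AU [BV D]]]]]].
  - apply card_spikes_closed.
  - apply card_spikes_closed.
  - intros p [[k [Jk ->]] [j [Nj E]]]; apply (f_equal (@proj1_sig _ _)) in E; simpl in E.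
    apply spike_inj in E; subst; contradiction.
  - destruct (card_closure_spikes x L U FC HL OU) as [k [Nk Uk]].
    + intros n k Hk; apply AU; exists k; split; [exists n; exact Hk|reflexivity].
    + destruct (Uk V OV) as [p [Vp Up]].
      * apply BV; exists k; split; [intros [n Hn]; apply (Nk n Hn)|reflexivity].
      * apply (D p); auto.
Qed.

(* Cover the card by the complement of [A = {spike x k : k in J}], [J] countable, and
   by neighbourhoods of the [spike x j], [j in J], whose closures contain no spike
   outside [A].  The members of a locally finite refinement that meet [A] have
   a union [U] with a spike outside [A] in its closure, hence in the closure
   of one of them. *)
Lemma product_card_not_paracompact (x : K -> Y) :
  first_countable Y -> ~ paracompact (card (product_space K Y) x).
Proof.
  intros FC HP; destruct (uncountable_sequence K HK) as [L HL].
  set (X := card (product_space K Y) x).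
  set (J := fun k => exists n, In k (L n)).
  set (A := fun p : X => exists k, J k /\ p = card_spike x k).
  assert (cyl : forall k V, is_open Y V -> is_open X (fun p : X => V (proj1_sig p k))).
  { intros k V OV.
    exact (subspace_incl_continuous (product_space K Y) _ _ (cylinder_open K Y k V OV)). }
  destruct (HP (fun U => U = (fun p => ~ A p) \/
      exists j V V', is_open Y V /\ is_open Y V' /\ V' (x j) /\ J j /\
        (forall y, ~ (V y /\ V' y)) /\ U = (fun p : X => V (proj1_sig p j))))
    as [G [OG [CG [RG LG]]]].
  - intros U [-> |[j [V [V' [OV [_ [_ [_ [_ ->]]]]]]]]]; [|apply cyl, OV].
    apply card_spikes_closed.
  - intros p; destruct (classic (A p)) as [[j [Jj ->]]|N].
    + destruct (HY _ _ (Halt (x j))) as [V [V' [OV [OV' [Vj [Vx D]]]]]].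
      exists (fun p : X => V (proj1_sig p j)); split.
      * right; exists j, V, V'; repeat (split; [assumption|]); reflexivity.
      * simpl; rewrite spike_at; exact Vj.
    + exists (fun p => ~ A p); auto.
  - set (U := fun p => exists V, (G V /\ exists q, V q /\ A q) /\ V p).
    assert (OU : is_open X U) by (apply open_union; intros V [GV _]; auto).
    destruct (card_closure_spikes x L U FC HL OU) as [k [Nk Uk]].
    { intros n k Hk; destruct (CG (card_spike x k)) as [V [GV Vk]].
      exists V; split; [|exact Vk]; split; [exact GV|].
      exists (card_spike x k); split; [exact Vk|].
      exists k; split; [exists n; exact Hk|reflexivity]. }
    destruct (LG (card_spike x k)) as [W [OW [Wk [l Hl]]]].
    destruct (common_nbhd X (card_spike x k) l (fun V p => (G V /\ exists q, V q /\ A q) -> ~ V p))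
      as [W' [OW' [Wk' HW']]].
    { intros V _.
      destruct (classic (G V /\ exists q, V q /\ A q)) as [[GV [q [Vq Aq]]]|N].
      - destruct (RG V GV) as [U0 [[-> |[j [V1 [V2 [_ [O2 [xj [Jj [D ->]]]]]]]]] VU]].
        + destruct (VU q Vq Aq).
        + exists (fun p : X => V2 (proj1_sig p j)); split; [apply cyl, O2|]; split.
          * simpl; rewrite spike_off; [exact xj|]; intros ->.
            destruct Jj as [n Hn]; apply (Nk n Hn).
          * intros p Vp _ Vp'; apply (D (proj1_sig p j)); split; [apply VU|]; assumption.
      - exists (fun _ => True); split; [apply open_full|]; split; [exact I|]; tauto. }
    destruct (Uk (fun p => W p /\ W' p)) as [p [[Wp Wp'] [V [GV Vp]]]].
    + apply open_inter; assumption.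
    + auto.
    + apply (HW' p Wp' V); [|exact GV|exact Vp].
      apply Hl; [apply GV|exists p; auto].
Qed.

Theorem product_reconstructible_with_bad_cards : first_countable Y -> compact Y -> inhabited Y ->
  reconstructible_with_bad_cards (product_space K Y).
Proof.
  intros FC CY [y0]; split.
  - apply reconstructible_of_locally_unsplit.
    + exact (fun _ => y0).
    + apply tychonoff, CY.
    + apply product_hausdorff, HY.
    + apply product_perfect.
    + apply product_locally_unsplit, FC.
  - intros x; split; [|split; [|split]].
    + intros HC; apply (product_card_not_lindelof x), compact_lindelof, HC.
    + apply product_card_not_paracompact, FC.
    + apply product_card_not_lindelof.
    + apply product_card_not_normal, FC.
Qed.

End Spikes.

(** * The two factors *)

Lemma discrete_bool_hausdorff : hausdorff discrete_bool.
Proof.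
  intros a b N; exists (fun c => c = a), (fun c => c = b); simpl.
  repeat split; auto; intros c [-> E]; auto.
Qed.

Lemma discrete_bool_first_countable : first_countable discrete_bool.
Proof.
  intros y; exists (fun _ u => u = y); split; [split; [exact I|reflexivity]|].
  intros V _ Vy; exists 0%nat; intros n _ u ->; exact Vy.
Qed.

Lemma discrete_bool_compact : compact discrete_bool.
Proof.
  intros F _ CF; destruct (CF true) as [U [FU Ut]], (CF false) as [V [FV Vf]].
  exists (U :: V :: nil); split.
  - intros W [<-|[<-|[]]]; assumption.
  - intros [|]; [exists U|exists V]; simpl; auto.
Qed.

Lemma R_ball_open (a r : R) : is_open R_space (fun y => Rabs (y - a) < r).
Proof.
  intros x Hx; exists (r - Rabs (x - a)); split; [lra|]; intros y Hy.
  pose proof (Rabs_triang (y - x) (x - a)) as T.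
  replace (y - x + (x - a)) with (y - a) in T by ring; lra.
Qed.

Lemma R_hausdorff : hausdorff R_space.
Proof.
  intros a b N; set (r := Rabs (a - b) / 2).
  assert (0 < r) by (unfold r; pose proof (Rabs_pos_lt (a - b)); lra).
  exists (fun y => Rabs (y - a) < r), (fun y => Rabs (y - b) < r).
  split; [apply R_ball_open|]; split; [apply R_ball_open|].
  split; [rewrite Rminus_diag, Rabs_R0; assumption|].
  split; [rewrite Rminus_diag, Rabs_R0; assumption|].
  intros p [Ha Hb]; rewrite Rabs_minus_sym in Ha.
  pose proof (Rabs_triang (a - p) (p - b)) as T.
  replace (a - p + (p - b)) with (a - b) in T by ring; unfold r in *; lra.
Qed.

Lemma unit_interval_first_countable : first_countable unit_interval.
Proof.
  intros y; exists (fun n u => Rabs (proj1_sig u - proj1_sig y) < / INR (S n)); split.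
  - intros n; split.
    + exact (subspace_incl_continuous R_space _ _ (R_ball_open (proj1_sig y) (/ INR (S n)))).
    + rewrite Rminus_diag, Rabs_R0; apply Rinv_0_lt_compat, lt_0_INR; lia.
  - intros V [V' [OV EV]] Vy; apply EV in Vy.
    destruct (OV _ Vy) as [eps [He HV]].
    destruct (archimed_cor1 eps He) as [m [Hm Pm]].
    exists m; intros n Hn u Hu; apply EV, HV.
    apply Rlt_trans with (1 := Hu), Rle_lt_trans with (2 := Hm).
    apply Rinv_le_contravar; [apply lt_0_INR; exact Pm|apply le_INR; lia].
Qed.

Lemma unit_interval_compact : compact unit_interval.
Proof.
  intros F OF CF.
  set (E := fun t => 0 <= t <= 1 /\ exists l, (forall U, In U l -> F U) /\
     forall u : unit_interval, proj1_sig u <= t -> exists U, In U l /\ U u).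
  assert (E0 : E 0).
  { split; [lra|].
    assert (H0 : 0 <= 0 <= 1) by lra.
    destruct (CF (exist _ 0 H0)) as [U [FU U0]].
    exists (U :: nil); split; [intros V [<-|[]]; exact FU|].
    intros u Hu; exists U; split; [simpl; auto|].
    replace u with (exist (fun r => 0 <= r <= 1) 0 H0); [exact U0|].
    apply sig_eq, Rle_antisym; [exact (proj1 (proj2_sig u))|exact Hu]. }
  destruct (completeness E) as [s [Us Ls]].
  { exists 1; intros t [Ht _]; lra. }
  { exists 0; exact E0. }
  assert (Hs : 0 <= s <= 1).
  { split; [apply Us, E0|apply Ls; intros t [Ht _]; lra]. }
  destruct (CF (exist _ s Hs)) as [V [FV Vs]].
  destruct (OF V FV) as [V' [OV EV]].
  apply EV in Vs; destruct (OV _ Vs) as [eps [He HV]]; simpl in HV.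
  assert (Ht : exists t, E t /\ s - eps < t).
  { apply NNPP; intros N.
    assert (s <= s - eps); [|lra]; apply Ls; intros t Et.
    apply Rnot_lt_le; intros L; apply N; exists t; auto. }
  destruct Ht as [t [[Ht [l [Fl Cl]]] Hst]].
  assert (Cs : forall u : unit_interval, proj1_sig u < s + eps ->
                 exists U, In U (V :: l) /\ U u).
  { intros u Hu; destruct (Rle_dec (proj1_sig u) t) as [L|G].
    - destruct (Cl u L) as [U [? ?]]; exists U; simpl; auto.
    - exists V; split; [simpl; auto|]; apply EV, HV, Rabs_def1; lra. }
  assert (Fs : forall U, In U (V :: l) -> F U) by (intros U [<-|HU]; auto).
  assert (E1 : 1 < s + eps / 2).
  { apply Rnot_le_lt; intros L; assert (s + eps / 2 <= s); [|lra].
    apply Us; split; [lra|]; exists (V :: l); split; [exact Fs|].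
    intros u Hu; apply Cs; lra. }
  exists (V :: l); split; [exact Fs|]; intros u; apply Cs.
  apply Rle_lt_trans with 1; [exact (proj2 (proj2_sig u))|lra].
Qed.

Lemma unit_interval_no_fixpoint : exists alt : unit_interval -> unit_interval,
  forall y, alt y <> y.
Proof.
  assert (H0 : 0 <= 0 <= 1) by lra; assert (H1 : 0 <= 1 <= 1) by lra.
  exists (fun y => if Req_dec_T (proj1_sig y) 0 then exist _ 1 H1 else exist _ 0 H0).
  intros y E; apply (@f_equal unit_interval R (fun u => proj1_sig u)) in E.
  destruct Req_dec_T as [e|n]; simpl in E.
  - apply R1_neq_R0; rewrite E; exact e.
  - apply n; symmetry; exact E.
Qed.

Theorem mainTheorem1 (K : Type) (HK : uncountable K) :
  reconstructible_with_bad_cards (cantor_cube K) /\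
  reconstructible_with_bad_cards (tychonoff_cube K).
Proof.
  split.
  - apply (product_reconstructible_with_bad_cards K discrete_bool negb HK).
    + apply discrete_bool_hausdorff.
    + intros []; discriminate.
    + apply discrete_bool_first_countable.
    + apply discrete_bool_compact.
    + exact (inhabits true).
  - destruct unit_interval_no_fixpoint as [alt Halt].
    apply (product_reconstructible_with_bad_cards K unit_interval alt HK).
    + apply subspace_hausdorff, R_hausdorff.
    + exact Halt.
    + apply unit_interval_first_countable.
    + apply unit_interval_compact.
    + assert (H0 : 0 <= 0 <= 1) by lra; exact (inhabits (exist _ 0 H0)).
Qed.
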